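(* Let $k\ge3$, let $a_1,\dots,a_{k-1},b\in\mathbb{R}$ with $(a_1,\dots,a_{k-1})\neq\mathbf 0$, and let $$\mathcal{P}_0=\Big\{\boldsymbol\pi\in\mathrm{int}(\Delta_{k-1}):\ \sum_{i=1}^{k-1}a_i\log\big(\tfrac{\pi_i}{\pi_k}\big)=b\Big\}.$$ There is an NTUB test of $\mathcal{P}_0$ for some sample size if and only if there exists a representation of $\mathcal{P}_0$ of the form $\{\boldsymbol\pi\in\mathrm{int}(\Delta_{k-1}):\sum_{i=1}^{k-1}a_i'\log(\pi_i/\pi_k)=b'\}$ in which every $a_i'$, $i=1,\dots,k-1$, is a rational number (that is, there exist $a_1',\dots,a_{k-1}'\in\mathbb{Q}$ and $b'\in\mathbb{R}$ with $\mathcal{P}_0=\{\boldsymbol\pi\in\mathrm{int}(\Delta_{k-1}):\sum_{i=1}^{k-1}a_i'\log(\pi_i/\pi_k)=b'\}$).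
   Context: $\Delta_{k-1}=\{\boldsymbol\pi\in\mathbb{R}^k:\pi_i\ge0,\ \sum_{i=1}^k\pi_i=1\}$ and $\mathrm{int}(\Delta_{k-1})$ is its relative interior (all $\pi_i>0$). The data are $\mathbf X\sim\text{Multinomial}_k(\boldsymbol\pi,n)$, $n$ being the sample size. The alternative hypothesis is $\mathcal{P}_A=\mathrm{int}(\Delta_{k-1})\setminus\mathcal{P}_0$, the complement of $\mathcal{P}_0$ in the natural parameter space of the multinomial exponential family (natural parameters $\theta_i=\log(\pi_i/\pi_k)$). A (randomized) test for sample size $n$ is a function $\phi:\{\mathbf x\in\mathbb{N}^k:\sum_i x_i=n\}\to[0,1]$; its power function is $\beta_\phi(\boldsymbol\pi)=E_{\boldsymbol\pi}(\phi(\mathbf X))=\sum_{\mathbf x}\phi(\mathbf x)\frac{n!}{x_1!\cdots x_k!}\prod_{i=1}^k\pi_i^{x_i}$. The test is unbiased if $\beta_\phi(\boldsymbol\pi_0)\le\beta_\phi(\boldsymbol\pi_A)$ for all $\boldsymbol\pi_0\in\mathcal{P}_0$, $\boldsymbol\pi_A\in\mathcal{P}_A$, and non-trivial unbiased (NTUB) if in addition $\beta_\phi$ is not a constant function. *)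

(* Defs.v *)
From mathcomp Require Import all_boot all_order all_algebra.
From mathcomp Require Import boolp classical_sets reals exp.

Set Implicit Arguments.
Unset Strict Implicit.
Unset Printing Implicit Defensive.

Import Order.TTheory GRing.Theory Num.Theory.

Local Open Scope classical_set_scope.
Local Open Scope ring_scope.

(* Relative interior of the probability simplex. *)
Definition int_simplex (R : realType) (k : nat) : set 'rV[R]_k :=
  [set p | (forall i : 'I_k, 0 < p 0 i) /\ \sum_i p 0 i = 1].

(* The sample space {x in N^k | \sum_i x_i = n}; such an x has all its entries
   at most n, so that it can be taken in the finite type 'I_n.+1 ^ k. *)
Definition counts (k n : nat) : Type :=
  {x : {ffun 'I_k -> 'I_n.+1} | (\sum_i x i)%N == n}.

Definition multinomial_pmf (R : realType) (k n : nat)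
    (p : 'rV[R]_k) (x : counts k n) : R :=
  (n`!)%:R / \prod_i ((val x i)`!)%:R * \prod_i p 0 i ^+ val x i.

Definition is_test (R : realType) (k n : nat) (phi : counts k n -> R) : Prop :=
  forall x, 0 <= phi x <= 1.

(* Power function: the expectation of phi(X) for X ~ Multinomial_k(p, n). *)
Definition power (R : realType) (k n : nat)
    (phi : counts k n -> R) (p : 'rV[R]_k) : R :=
  \sum_(x : counts k n) phi x * multinomial_pmf p x.

Definition alternative (R : realType) (k : nat) (P0 : set 'rV[R]_k) :
  set 'rV[R]_k := @int_simplex R k `\` P0.

Definition unbiased (R : realType) (k n : nat)
    (P0 : set 'rV[R]_k) (phi : counts k n -> R) : Prop :=
  forall p0 pA, P0 p0 -> alternative P0 pA -> power phi p0 <= power phi pA.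

(* The power function is a function on the parameter space int_simplex. *)
Definition ntub (R : realType) (k n : nat)
    (P0 : set 'rV[R]_k) (phi : counts k n -> R) : Prop :=
  [/\ is_test phi, unbiased P0 phi &
      ~ exists c : R, forall p, @int_simplex R k p -> power phi p = c].

(* There are k.+1 categories; the reference category of the natural parameters
   ln (p_i / p_last) is ord_max, and i : 'I_k runs over the other ones. *)
Definition loglinear_null (R : realType) (k : nat) (a : 'rV[R]_k) (b : R) :
    set 'rV[R]_k.+1 :=
  [set p | @int_simplex R k.+1 p /\
     \sum_(i < k) a 0 i * ln (p 0 (widen_ord (leqnSn k) i) / p 0 ord_max) = b].

(* Main.v *)
(* In the log-odds coordinates th, the monomial p^x is Z(th)^-n exp (x . th).
   A power function of an unbiased test is constant on the null hyperplane
   a . th = b by continuity, so subtracting the constant times (sum p)^n gives a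
   combination of the functions exp (x . th) that vanishes on it.  Unless two
   count vectors differ by a multiple of a, which makes a proportional to an
   integer vector, these are distinct characters of the space orthogonal to a,
   hence linearly independent, and the power function is constant.
   Conversely an integer a turns the null into p^u = e^b p^v with u and v of the
   same degree, and e (C (sum p)^n + (p^u - e^b p^v)^2) is a power function. *)
Require Import Defs.
From mathcomp Require Import all_boot all_order all_algebra.
From mathcomp Require Import boolp classical_sets reals exp.
From mathcomp Require Import ring topology normedtype sequences realfun.

Set Implicit Arguments.
Unset Strict Implicit.
Unset Printing Implicit Defensive.

Import Order.TTheory GRing.Theory Num.Theory.
Import numFieldNormedType.Exports.

Local Open Scope classical_set_scope.
Local Open Scope ring_scope.

(** * Linear independence of characters *)

(** Dedekind's argument: the relation at [v] times [chi x w], minus the relation at [v + w], has no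
    term in [x]. The induction hypothesis then applies to a shorter relation. *)
Lemma characters_free (R : fieldType) (V : zmodType) (I : eqType)
    (chi : I -> V -> R) (s : seq I) (c : I -> R) :
  (forall i, chi i 0 = 1) ->
  (forall i u v, chi i (u + v) = chi i u * chi i v) ->
  {in s &, forall i j, i != j -> exists w, chi i w != chi j w} ->
  uniq s ->
  (forall v, \sum_(i <- s) c i * chi i v = 0) ->
  {in s, forall i, c i = 0}.
Proof.
move=> chi0 chiD; elim: s c => // x s IH c sep /= /andP[xs us] c0.
have cs : {in s, forall i, c i = 0}.
  move=> i si; have [|||w xiw] := sep x i; rewrite ?inE ?eqxx ?si ?orbT //.
    by apply: contraNneq xs => ->.
  (* Here [w] separates [x] from this [i] only; the other new coefficients may vanish, so the
     relation is rebuilt for each [i]. *)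
  have /(_ i si)/eqP : {in s, forall i, c i * (chi x w - chi i w) = 0}.
    apply: IH => // [y z ys zs|v]; first by apply: sep; rewrite inE ?ys ?zs orbT.
    have := c0 (v + w); have /(congr1 ( *%R^~ (chi x w))) := c0 v.
    rewrite !big_cons chiD mul0r mulrDl mulrA => E1 E2.
    have := congr2 (fun y z => y - z) E1 E2.
    rewrite /= subr0 opprD addrACA subrr add0r mulr_suml -sumrB => {2}<-.
    apply: eq_bigr => j _; rewrite chiD mulrBr mulrBl -!mulrA.
    by rewrite (mulrC (chi x w)) (mulrC (chi j w)).
  by rewrite mulf_eq0 subr_eq0 (negPf xiw) orbF => /eqP.
move=> i; rewrite inE => /orP[/eqP->|/cs//].
have := c0 0; rewrite big_cons chi0 mulr1 big_seq big1 ?addr0 // => j js.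
by rewrite cs ?mul0r.
Qed.

(** * Homogeneous polynomials as power functions *)

Section Counting.
Variables (R : realType) (k n : nat).
Implicit Types (p : 'rV[R]_k) (x : counts k n) (g : {ffun 'I_n -> 'I_k}).

Lemma card_fiber_lt g i : (#|[pred j | g j == i]| < n.+1)%N.
Proof. by rewrite ltnS -[leqRHS]card_ord max_card. Qed.

Lemma count_subproof g :
  (\sum_i [ffun i => inord #|[pred j | g j == i]| : 'I_n.+1] i)%N == n.
Proof.
apply/eqP; rewrite -[RHS]card_ord -sum1_card (partition_big g xpredT) //=.
by apply: eq_bigr => i _; rewrite ffunE inordK ?card_fiber_lt // -sum1_card.
Qed.

Definition count_of g : counts k n :=
  exist (fun x : {ffun 'I_k -> 'I_n.+1} => (\sum_i x i)%N == n) _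
    (count_subproof g).

Lemma prod_count_of g p :
  \prod_j p 0 (g j) = \prod_i p 0 i ^+ val (count_of g) i.
Proof.
rewrite (partition_big g xpredT) //=; apply: eq_bigr => i _.
rewrite ffunE inordK ?card_fiber_lt //.
by rewrite -prodr_const; apply: eq_bigr => j /eqP->.
Qed.

(** Ordered draws are grouped by their counts. Powers of the total probability expand over draws by
    plain distributivity, so fibres of [count_of] never have to be counted. *)
Lemma sum_draws (h : {ffun 'I_n -> 'I_k} -> R) p :
  \sum_g h g * \prod_j p 0 (g j) =
  \sum_x (\sum_(g | count_of g == x) h g) * \prod_i p 0 i ^+ val x i.
Proof.
rewrite (partition_big count_of xpredT) //=; apply: eq_bigr => x _.
by rewrite mulr_suml; apply: eq_bigr => g /eqP <-; rewrite prod_count_of.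
Qed.

Lemma expr_sum_draws p : (\sum_i p 0 i) ^+ n =
  \sum_(g : {ffun 'I_n -> 'I_k}) \prod_j p 0 (g j).
Proof. by rewrite -(bigA_distr_bigA (fun _ i => p 0 i)) prodr_const card_ord. Qed.

Lemma multinomial_coeff_gt0 x :
  0 < (n`!)%:R / \prod_i ((val x i)`!)%:R :> R.
Proof.
by rewrite divr_gt0 ?ltr0n ?fact_gt0 // prodr_gt0 // => i _; rewrite ltr0n fact_gt0.
Qed.

(** Collecting terms by counts and dividing by the multinomial coefficients gives nonnegative
    weights [psi]. Dividing by one plus their sum keeps the denominator positive and brings each
    weight below 1. *)
Lemma draws_test (h : {ffun 'I_n -> 'I_k} -> R) : (forall g, 0 <= h g) ->
  exists2 e : R, 0 < e & exists2 phi : counts k n -> R, is_test phi &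
    forall p, power phi p = e * \sum_g h g * \prod_j p 0 (g j).
Proof.
move=> h0.
pose M x : R := (n`!)%:R / \prod_i ((val x i)`!)%:R.
pose psi x := (\sum_(g | count_of g == x) h g) / M x.
have psi0 x : 0 <= psi x.
  by rewrite divr_ge0 ?sumr_ge0 // ltW // multinomial_coeff_gt0.
have S0 : 0 <= \sum_x psi x by rewrite sumr_ge0.
have S1 : 0 < 1 + \sum_x psi x by rewrite ltr_wpDr.
exists (1 + \sum_x psi x)^-1; first by rewrite invr_gt0.
exists (fun x => (1 + \sum_x psi x)^-1 * psi x) => [x|p].
  apply/andP; split; first by rewrite mulr_ge0 // invr_ge0 ltW.
  rewrite mulrC ler_pdivrMr // mul1r.
  by rewrite (bigD1 x) //= addrCA lerDl addr_ge0 ?sumr_ge0.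
rewrite sum_draws mulr_sumr; apply: eq_bigr => x _.
rewrite /multinomial_pmf -/(M x) -mulrA [psi x * _]mulrA divfK //.
by rewrite gt_eqF // multinomial_coeff_gt0.
Qed.

End Counting.

(* The constant 2 v compensates the negative coefficient of the cross term of
   the square, so that all coefficients of the form are nonnegative. *)
Lemma square_test (R : realType) (k m : nat) (s t : m.-tuple 'I_k) (v : R) :
  0 <= v ->
  exists2 e : R, 0 < e & exists2 phi : counts k (m + m) -> R, is_test phi &
    forall p, int_simplex p -> power phi p =
      e * (2 * v + (\prod_(i <- s) p 0 i - v * \prod_(i <- t) p 0 i) ^+ 2).
Proof.
move=> v0.
pose draw (u : (m + m).-tuple 'I_k) : {ffun 'I_(m + m) -> 'I_k} :=
  [ffun j => tnth u j].
(* The constant term sums to [2 * v] times a power of the total probability, which is 1; each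
   indicator selects one ordered draw realizing a product of the expanded square. *)
pose h (g : {ffun 'I_(m + m) -> 'I_k}) : R := 2 * v + (g == draw [tuple of s ++ s])%:R
  - 2 * v * (g == draw [tuple of s ++ t])%:R
  + v ^+ 2 * (g == draw [tuple of t ++ t])%:R.
have h0 g : 0 <= h g.
  rewrite /h addr_ge0 ?mulr_ge0 ?exprn_ge0 // addrAC addr_ge0 //.
  by case: (g == _); rewrite ?mulr1 ?subrr ?mulr0 ?subr0 ?mulr_ge0.
have [e e0 [phi tphi phiE]] := draws_test h0.
exists e => //; exists phi => // p [_ p1]; rewrite phiE; congr (_ * _).
have pick (u : (m + m).-tuple 'I_k) :
    \sum_g (g == draw u)%:R * \prod_j p 0 (g j) = \prod_(i <- u) p 0 i.
  rewrite (bigD1 (draw u)) //= eqxx mul1r [X in _ + X]big1 ?addr0.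
    by rewrite [RHS]big_tuple; apply: eq_bigr => j _; rewrite ffunE.
  by move=> g /negPf->; rewrite mul0r.
transitivity (2 * v * (\sum_i p 0 i) ^+ (m + m)
  + \prod_(i <- s ++ s) p 0 i - 2 * v * \prod_(i <- s ++ t) p 0 i
  + v ^+ 2 * \prod_(i <- t ++ t) p 0 i).
  rewrite expr_sum_draws.
  rewrite -(pick [tuple of s ++ s]) -(pick [tuple of s ++ t]) -(pick [tuple of t ++ t]).
  rewrite !mulr_sumr -big_split -sumrB -big_split /=; apply: eq_bigr => g _.
  by rewrite /h /=; ring.
by rewrite p1 expr1n !big_cat /=; ring.
Qed.

Lemma tuple_of_exponents (k : nat) (u : 'I_k -> nat) :
  exists s : (\sum_i u i)%N.-tuple 'I_k,
    forall (R : comPzRingType) (F : 'I_k -> R), \prod_(i <- s) F i = \prod_i F i ^+ u i.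
Proof.
pose s := flatten [seq nseq (u i) i | i <- index_enum 'I_k].
have ss : size s == (\sum_i u i)%N.
  rewrite size_flatten sumnE /shape -map_comp big_map.
  by under eq_bigr do rewrite /= size_nseq.
exists (Tuple ss) => R F; rewrite big_flatten big_map.
by apply: eq_bigr => i _; rewrite big_nseq iter_mulr_1.
Qed.

(** * Scalar product and orthogonal projection *)

Section Dot.
Variables (R : realType) (k : nat).
Implicit Types u v w : 'rV[R]_k.

Definition dot u v : R := \sum_i u 0 i * v 0 i.

Lemma dotC u v : dot u v = dot v u.
Proof. by apply: eq_bigr => i _; rewrite mulrC. Qed.

Lemma dotDr w u v : dot w (u + v) = dot w u + dot w v.
Proof. by rewrite -big_split; apply: eq_bigr => i _; rewrite mxE mulrDr. Qed.

Lemma dotZr w c v : dot w (c *: v) = c * dot w v.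
Proof. by rewrite mulr_sumr; apply: eq_bigr => i _; rewrite mxE mulrCA. Qed.

Lemma dotZl w c v : dot (c *: w) v = c * dot w v.
Proof. by rewrite dotC dotZr dotC. Qed.

Lemma dotBr w u v : dot w (u - v) = dot w u - dot w v.
Proof. by rewrite -scaleN1r dotDr dotZr mulN1r. Qed.

Lemma dot0r w : dot w 0 = 0.
Proof. by rewrite -(scale0r 0) dotZr mul0r. Qed.

Lemma dot_eq0 u : (dot u u == 0) = (u == 0).
Proof.
apply/idP/eqP => [|->]; last by rewrite dot0r.
rewrite psumr_eq0 => [/allP u0|i _]; last exact: sqr_ge0.
apply/rowP => i; rewrite mxE; apply/eqP.
by have := u0 i (mem_index_enum i); rewrite mulf_eq0 orbb.
Qed.

(** Projection onto the orthogonal complement of [a], not onto its line. Characters of that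
    complement can thus be evaluated at arbitrary vectors. *)
Definition orth_proj (a v : 'rV[R]_k) := v - (dot v a / dot a a) *: a.

Lemma orth_projD a u v : orth_proj a (u + v) = orth_proj a u + orth_proj a v.
Proof.
by rewrite /orth_proj dotC dotDr !(dotC a) mulrDl scalerDl opprD addrACA.
Qed.

Lemma dot_orth_proj a u v : dot u (orth_proj a v) = dot (orth_proj a u) v.
Proof.
rewrite dotBr dotZr [RHS]dotC dotBr dotZr (dotC u v) (dotC u a) (dotC v a).
by congr (_ - _); rewrite mulrAC [RHS]mulrAC (mulrC (dot a v)).
Qed.

Lemma dot_orth_proj0 a v : a != 0 -> dot a (orth_proj a v) = 0.
Proof.
by rewrite -dot_eq0 => a0; rewrite dotBr dotZr divfK // dotC subrr.
Qed.

End Dot.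

(** * Natural parameters of the open simplex *)

Section Parametrization.
Variables (R : realType) (k : nat).
Implicit Types (th a : 'rV[R]_k) (p : 'rV[R]_k.+1).

(** [insub] fails exactly at [ord_max], where the default 1 is the odds of the reference category
    against itself. *)
Definition odds th (i : 'I_k.+1) : R :=
  oapp (fun j : 'I_k => expR (th 0 j)) 1 (insub (i : nat)).

Lemma odds_widen th (j : 'I_k) : odds th (widen_ord (leqnSn k) j) = expR (th 0 j).
Proof. by rewrite /odds /= valK. Qed.

Lemma odds_max th : odds th ord_max = 1.
Proof. by rewrite /odds insubF //= ltnn. Qed.

Lemma odds_gt0 th i : 0 < odds th i.
Proof. by rewrite /odds; case: insub => //= j; rewrite expR_gt0. Qed.

Lemma sum_odds_gt0 th : 0 < \sum_i odds th i.
Proof.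
by rewrite big_ord_recr /= odds_max ltr_wpDl // sumr_ge0 // => i _; rewrite ltW ?odds_gt0.
Qed.

Definition simplex_pt th : 'rV[R]_k.+1 := \row_i (odds th i / \sum_j odds th j).

Definition log_odds p : 'rV[R]_k :=
  \row_i ln (p 0 (widen_ord (leqnSn k) i) / p 0 ord_max).

Lemma simplex_pt_int th : int_simplex (simplex_pt th).
Proof.
split=> [i|]; first by rewrite mxE divr_gt0 ?odds_gt0 ?sum_odds_gt0.
under eq_bigr do rewrite mxE.
by rewrite -mulr_suml divff // gt_eqF ?sum_odds_gt0.
Qed.

Lemma simplex_ptK : cancel simplex_pt log_odds.
Proof.
move=> th; apply/rowP => i; rewrite !mxE odds_widen odds_max mul1r.
by rewrite invrK divfK ?expRK // gt_eqF ?sum_odds_gt0.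
Qed.

Lemma log_oddsK p : int_simplex p -> simplex_pt (log_odds p) = p.
Proof.
move=> [p0 p1].
have E i : odds (log_odds p) i = p 0 i / p 0 ord_max.
  case: (unliftP ord_max i) => [j ->|->]; last by rewrite odds_max divff ?gt_eqF.
  have -> : lift ord_max j = widen_ord (leqnSn k) j by apply: val_inj; rewrite [LHS]lift_max.
  by rewrite odds_widen mxE lnK // posrE divr_gt0.
apply/rowP => i; rewrite mxE E; under eq_bigr do rewrite E.
by rewrite -mulr_suml p1 mul1r invrK divfK ?gt_eqF.
Qed.

Lemma loglinear_nullE a b p :
  loglinear_null a b p <-> int_simplex p /\ dot a (log_odds p) = b.
Proof.
rewrite /loglinear_null /= /dot; under [in X in _ <-> X]eq_bigr do rewrite mxE.
by [].
Qed.

Lemma simplex_pt_null a b th : loglinear_null a b (simplex_pt th) <-> dot a th = b.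
Proof.
rewrite loglinear_nullE simplex_ptK; split=> [[]//|ab]; split=> //.
exact: simplex_pt_int.
Qed.

Lemma loglinear_nullZ a b (c : R) : c != 0 ->
  loglinear_null (c *: a) (c * b) = loglinear_null a b.
Proof.
move=> c0; apply/seteqP; split=> p; rewrite !loglinear_nullE dotZl.
  by move=> [? /(mulfI c0)].
by move=> [? ->].
Qed.

Lemma loglinear_null_nonempty a b : a != 0 ->
  exists p, loglinear_null a b p.
Proof.
rewrite -dot_eq0 => a0; exists (simplex_pt ((b / dot a a) *: a)).
by rewrite simplex_pt_null dotZr divfK.
Qed.

Lemma alternative_nonempty a b : a != 0 ->
  exists p, alternative (loglinear_null a b) p.
Proof.
move=> a0; have [p [pi pb]] := loglinear_null_nonempty (b + 1) a0.
exists p; split=> // -[_]; rewrite pb => /eqP.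
by rewrite addrC -subr_eq0 addrK oner_eq0.
Qed.

(** All count vectors have total [n], so the normalizing factor is common to them and cancels from
    any linear relation between monomials. *)
Lemma monomial_simplex_pt n (x : counts k.+1 n) th :
  \prod_i simplex_pt th 0 i ^+ val x i = (\sum_j odds th j) ^- n *
    expR (dot (\row_i (val x (widen_ord (leqnSn k) i))%:R) th).
Proof.
under eq_bigr do rewrite mxE exprMn.
rewrite big_split /= mulrC; congr (_ * _).
  by rewrite prodrXr (eqP (valP x)) exprVn.
rewrite big_ord_recr /= odds_max expr1n mulr1 expR_sum.
by apply: eq_bigr => i _; rewrite odds_widen mxE expRM_natl.
Qed.

Lemma cvg_power n (phi : counts k.+1 n -> R) T (F : set_system T)
    (f : T -> 'rV[R]_k.+1) p : Filter F ->
  (forall i, f t 0 i @[t --> F] --> p 0 i) ->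
  power phi (f t) @[t --> F] --> power phi p.
Proof.
move=> FF fp; apply: cvg_big => [|x _]; first exact: add_continuous.
apply: cvgM; first exact: cvg_cst.
apply: cvgM; first exact: cvg_cst.
apply: cvg_big => [|i _]; first exact: mul_continuous.
exact: (cvg_comp _ _ (fp i) (@exprn_continuous R _ _)).
Qed.

Lemma cvg_simplex_pt th v i :
  simplex_pt (th + t *: v) 0 i @[t --> (0 : R)] --> simplex_pt th 0 i.
Proof.
have oc j : odds (th + t *: v) j @[t --> (0 : R)] --> odds th j.
  rewrite /odds; case: insub => [l|] /=; last exact: cvg_cst.
  under eq_cvg do rewrite !mxE.
  have H : th 0 l + t * v 0 l @[t --> (0 : R)] --> th 0 l + 0 * v 0 l.
    by apply: cvgD; [exact: cvg_cst|apply: cvgMr_tmp; exact: cvg_id].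
  rewrite mul0r addr0 in H.
  exact: (cvg_comp _ _ H (@continuous_expR R _)).
rewrite mxE; under eq_cvg do rewrite mxE.
apply: cvgM => //; apply: cvgV; first by rewrite gt_eqF ?sum_odds_gt0.
by apply: cvg_big => //; exact: add_continuous.
Qed.

(* The path log_odds p1 + t a leaves the null hyperplane at once, so that
   unbiasedness passes to the limit t -> 0. *)
Lemma unbiased_le n (phi : counts k.+1 n -> R) a b p0 p1 :
  a != 0 -> unbiased (loglinear_null a b) phi ->
  loglinear_null a b p0 -> loglinear_null a b p1 -> power phi p0 <= power phi p1.
Proof.
move=> a0 ub n0 /loglinear_nullE[ip1 ap1]; rewrite leNgt; apply/negP => lt10.
have /cvgr_lt/(_ _ lt10) : power phi (simplex_pt (log_odds p1 + t *: a)) @[t --> (0 : R)]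
    --> power phi p1.
  by apply: cvg_power => i; rewrite -{2}(log_oddsK ip1); exact: cvg_simplex_pt.
move=> /nbhs_dnbhs H.
have [t [tlt t0]] := filter_ex (filterI H (nbhs_dnbhs_neq (0 : R))).
move: tlt; rewrite ltNge => /negP; apply; apply: ub => //.
split; first exact: simplex_pt_int.
rewrite simplex_pt_null dotDr dotZr ap1 => /eqP.
by rewrite addrC -subr_eq0 addrK mulf_eq0 (negPf t0) dot_eq0 (negPf a0).
Qed.

(** The last count is determined by the total [n]. *)
Lemma row_counts_inj n (x y : counts k.+1 n) :
  (forall i, val x (widen_ord (leqnSn k) i) = val y (widen_ord (leqnSn k) i)) -> x = y.
Proof.
move=> xy; apply: val_inj; apply/ffunP => i.
case: (unliftP ord_max i) => [j ->|->].
  have -> : lift ord_max j = widen_ord (leqnSn k) j by apply: val_inj; rewrite [LHS]lift_max.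
  exact: xy.
apply: val_inj; apply/eqP.
have := etrans (eqP (valP x)) (esym (eqP (valP y))); rewrite !big_ord_recr /=.
by under eq_bigr do rewrite xy; move/addnI => ->.
Qed.

Lemma vanishing_on_null n (coef : counts k.+1 n -> R) a b : a != 0 ->
  (forall (a' : 'rV[rat]_k) (b' : R),
     loglinear_null a b <> loglinear_null (map_mx (@ratr R) a') b') ->
  (forall p, loglinear_null a b p -> \sum_x coef x * \prod_i p 0 i ^+ val x i = 0) ->
  forall x, coef x = 0.
Proof.
move=> a0 irr van.
pose e (x : counts k.+1 n) : 'rV[R]_k := \row_i (val x (widen_ord (leqnSn k) i))%:R.
pose chi x v := expR (dot (e x) (orth_proj a v)).
pose th0 := (b / dot a a) *: a.
have th0E : dot a th0 = b by rewrite dotZr divfK // dot_eq0.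
(* [th0] is a base point of the null hyperplane; its exponential factor is absorbed into the
   coefficients, leaving characters of the orthogonal complement of [a]. *)
suff H : {in index_enum _, forall x, coef x * expR (dot (e x) th0) = 0}.
  move=> x; have /eqP := H x (mem_index_enum x).
  by rewrite mulf_eq0 (gt_eqF (expR_gt0 _)) orbF => /eqP.
apply: (@characters_free _ _ _ chi).
- by move=> x; rewrite /chi dot_orth_proj dot0r expR0.
- by move=> x u v; rewrite /chi orth_projD dotDr expRD.
- move=> x y _ _ xy; apply: contrapT => /forallNP same.
  (* If the two characters agree everywhere, evaluating them at the projection of [d] shows that
     this projection has squared norm 0, so [d] is a multiple of [a]. *)
  pose d := e x - e y.
  have d0 : orth_proj a d = 0.
    apply/eqP; rewrite -dot_eq0 -dot_orth_proj dotC dotBr !(dotC (orth_proj _ _)).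
    have /negP/negPn/eqP/expR_inj -> := same (orth_proj a d).
    by rewrite subrr.
  have dE : d = (dot d a / dot a a) *: a by apply/eqP; rewrite -subr_eq0 -/(orth_proj a d) d0.
  (* Factor 0 would force [x = y]; otherwise [d] is an integer normal vector of the same hyperplane,
     against [irr]. *)
  have [l0|l0] := eqVneq (dot d a / dot a a) 0.
    move: dE; rewrite l0 scale0r => /eqP; rewrite subr_eq0 => /eqP exy.
    move/eqP: xy; apply; apply: row_counts_inj => i; apply: val_inj; apply/eqP.
    by move/rowP: exy => /(_ i); rewrite !mxE => /eqP; rewrite eqr_nat.
  apply: (irr (\row_i ((val x (widen_ord (leqnSn k) i))%:R
    - (val y (widen_ord (leqnSn k) i))%:R)) (dot d a / dot a a * b)).
  rewrite -(loglinear_nullZ _ _ l0) -dE; congr loglinear_null.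
  by apply/rowP => i; rewrite !mxE rmorphB /= !ratr_nat.
- exact: index_enum_uniq.
- move=> v; have /van : loglinear_null a b (simplex_pt (th0 + orth_proj a v)).
    by rewrite simplex_pt_null dotDr dot_orth_proj0 // addr0.
  under eq_bigr do rewrite monomial_simplex_pt dotDr expRD mulrCA.
  rewrite -mulr_sumr => /eqP; rewrite mulf_eq0 invr_eq0 expf_eq0.
  rewrite (gt_eqF (sum_odds_gt0 _)) andbF => /eqP; apply: etrans.
  by apply: eq_bigr => x _; rewrite mulrA.
Qed.

End Parametrization.

(** * An NTUB test forces rational coefficients *)

Lemma ntub_rational (R : realType) (k n : nat) (a : 'rV[R]_k) (b : R)
    (phi : counts k.+1 n -> R) :
  a != 0 -> ntub (loglinear_null a b) phi ->
  exists (a' : 'rV[rat]_k) (b' : R),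
    loglinear_null a b = loglinear_null (map_mx (@ratr R) a') b'.
Proof.
move=> a0 [_ ub nontriv]; apply: contrapT => irr; apply: nontriv.
have [p0 null0] := loglinear_null_nonempty b a0.
exists (power phi p0) => p ip.
(* The sum of ones counts the draws with counts [x], which is the coefficient of that monomial in
   the expanded power of the total probability. *)
pose coef x := phi x * ((n`!)%:R / \prod_i ((val x i)`!)%:R)
  - power phi p0 * \sum_(g | count_of g == x) 1.
have powerB q : int_simplex q ->
    power phi q - power phi p0 = \sum_x coef x * \prod_i q 0 i ^+ val x i.
  move=> [_ q1].
  have <- : power phi p0 * (\sum_i q 0 i) ^+ n = power phi p0.
    by rewrite q1 expr1n mulr1.
  rewrite expr_sum_draws; under [in X in _ - X]eq_bigr do rewrite -[\prod_j _]mul1r.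
  rewrite sum_draws mulr_sumr -sumrB; apply: eq_bigr => x _.
  by rewrite mulrBl /multinomial_pmf !mulrA.
have coef0 : forall x, coef x = 0.
  apply: (@vanishing_on_null _ _ _ _ a b a0) => [a' b' E|q nq].
    by apply: irr; exists a', b'.
  rewrite -powerB; last by case: nq.
  by apply/eqP; rewrite subr_eq0 eq_le !(unbiased_le a0 ub).
apply/eqP; rewrite -subr_eq0 powerB // big1 // => x _.
by rewrite coef0 mul0r.
Qed.

(** * Construction of an NTUB test from rational coefficients *)

Lemma dot_log_odds_nat (R : realType) (k : nat) (f : 'I_k -> nat) (p : 'rV[R]_k.+1) :
  int_simplex p ->
  dot (\row_i (f i)%:R) (log_odds p) =
  ln (\prod_i p 0 (widen_ord (leqnSn k) i) ^+ f i)
    - ln (p 0 ord_max ^+ (\sum_i f i)%N).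
Proof.
move=> [p0 _].
have pos i : p 0 i \is Num.pos by rewrite posrE.
have -> : ln (\prod_i p 0 (widen_ord (leqnSn k) i) ^+ f i) =
    \sum_i ln (p 0 (widen_ord (leqnSn k) i)) *+ f i.
  have lnM_prod (F : 'I_k -> R) : (forall i, 0 < F i) ->
      ln (\prod_i F i) = \sum_i ln (F i).
    move=> F0; suff [] : ln (\prod_i F i) = \sum_i ln (F i) /\ 0 < \prod_i F i by [].
    elim/big_ind2: _ => [|x1 x2 y1 y2 [<- x0] [<- y0]|//]; first by rewrite ln1.
    by rewrite lnM ?posrE ?mulr_gt0.
  rewrite lnM_prod => [|i]; last by rewrite exprn_gt0.
  by apply: eq_bigr => i _; rewrite lnXn.
rewrite lnXn // -sumrMnr -sumrB; apply: eq_bigr => i _.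
by rewrite !mxE ln_div // mulr_natl mulrnBl.
Qed.

(* The exponent of the last category is chosen so that both monomials have the
   same degree. *)
Lemma natural_ntub (R : realType) (k : nat) (f g : 'I_k -> nat) (b : R) :
  let P0 := loglinear_null (\row_i ((f i)%:R - (g i)%:R)) b in
  (exists p, P0 p) -> (exists p, alternative P0 p) ->
  exists n (phi : counts k.+1 n -> R), ntub P0 phi.
Proof.
move=> P0 [p0 null0] [pA altA].
pose ext (f1 f2 : 'I_k -> nat) (i : 'I_k.+1) : nat :=
  oapp f1 (\sum_i f2 i)%N (insub (i : nat)).
have ext_sum f1 f2 : (\sum_i ext f1 f2 i = \sum_i f1 i + \sum_i f2 i)%N.
  rewrite big_ord_recr /= {2}/ext insubF ?ltnn //; congr (_ + _)%N.
  by apply: eq_bigr => i _; rewrite /ext /= valK.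
have ext_prod f1 f2 (p : 'rV[R]_k.+1) : \prod_i p 0 i ^+ ext f1 f2 i =
    (\prod_i p 0 (widen_ord (leqnSn k) i) ^+ f1 i) * p 0 ord_max ^+ (\sum_i f2 i)%N.
  rewrite big_ord_recr /= {2}/ext insubF ?ltnn //; congr (_ * _).
  by apply: eq_bigr => i _; rewrite /ext /= valK.
have [s sE] := tuple_of_exponents (ext f g).
have [t tE] := tuple_of_exponents (ext g f).
have st : (\sum_i ext g f i = \sum_i ext f g i)%N by rewrite !ext_sum addnC.
(* The two tuples must have the same length in their types, as [square_test] requires. *)
rewrite st in t tE.
have [e e0 [phi tphi phiE]] := square_test s t (expR_ge0 b).
exists _, phi.
pose D (p : 'rV[R]_k.+1) := \prod_i p 0 i ^+ ext f g i - expR b * \prod_i p 0 i ^+ ext g f i.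
have powerE p : int_simplex p -> power phi p = e * (2 * expR b + D p ^+ 2).
  by move=> ip; rewrite phiE // sE tE.
have nullE p : int_simplex p -> P0 p <-> D p = 0.
  move=> ip; have [p_gt0 _] := ip.
  have pos f1 f2 : 0 < \prod_i p 0 i ^+ ext f1 f2 i.
    by rewrite prodr_gt0 // => i _; rewrite exprn_gt0.
  have posw f1 : 0 < \prod_i p 0 (widen_ord (leqnSn k) i) ^+ f1 i.
    by rewrite prodr_gt0 // => i _; rewrite exprn_gt0.
  have dotE : dot (\row_i ((f i)%:R - (g i)%:R)) (log_odds p) =
      ln (\prod_i p 0 i ^+ ext f g i) - ln (\prod_i p 0 i ^+ ext g f i).
    have -> : \row_i ((f i)%:R - (g i)%:R) = \row_i (f i)%:R - \row_i (g i)%:R :> 'rV[R]_k.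
      by apply/rowP => i; rewrite !mxE.
    rewrite dotC dotBr !(dotC (log_odds p)) !dot_log_odds_nat // !ext_prod.
    by rewrite !lnM ?posrE ?exprn_gt0 //; ring.
  rewrite /P0 loglinear_nullE dotE /D; split=> [[_]|/eqP].
    move=> E; apply/eqP; rewrite subr_eq0 -E expRD expRN !lnK ?posrE //.
    by rewrite divfK // gt_eqF.
  rewrite subr_eq0 => /eqP ->; split=> //.
  by rewrite lnM ?posrE ?expR_gt0 // expRK addrK.
have null_power p : P0 p -> power phi p = e * (2 * expR b).
  move=> np; have ip : int_simplex p by case: np.
  by rewrite powerE // (nullE p ip).1 // expr0n addr0.
(* Off the null the square is positive. This strict gap gives unbiasedness, and non-triviality
   because both hypotheses are non-empty. *)
have alt_power p : alternative P0 p -> e * (2 * expR b) < power phi p.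
  move=> [ip np]; rewrite powerE // ltr_pM2l // ltrDl exprn_even_gt0 //=.
  by apply: contra_notN np => /eqP /(nullE p ip).
split=> // [q0 qA nq aq|[c cE]]; first by rewrite null_power // ltW // alt_power.
have := alt_power _ altA; rewrite cE; last by case: altA.
by rewrite -(null_power p0) // cE ?ltxx //; case: null0.
Qed.

(** Multiplying by the product of all denominators gives integers, which are then split into
    positive and negative parts. *)
Lemma rat_row_scale (R : realType) (k : nat) (a : 'rV[rat]_k) :
  exists2 c : R, c != 0 & exists f g : 'I_k -> nat,
    c *: map_mx (@ratr R) a = \row_i ((f i)%:R - (g i)%:R).
Proof.
pose c : int := \prod_i denq (a 0 i).
have c0 : c != 0 by apply/prodf_neq0 => i _; exact: denq_neq0.
pose z i : int := numq (a 0 i) * \prod_(j | j != i) denq (a 0 j).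
exists c%:~R; first by rewrite intr_eq0.
exists (fun i => if z i is Posz m then m else 0%N),
       (* [Negz m] stands for the integer [-(m + 1)]. *)
       (fun i => if z i is Negz m then m.+1 else 0%N).
apply/rowP => i; rewrite !mxE.
have -> : c%:~R * ratr (a 0 i) = (z i)%:~R :> R.
  rewrite -(ratr_int R c) -(ratr_int R (z i)) -rmorphM /=; congr ratr.
  rewrite /c /z (bigD1 i) //= -{2}(divq_num_den (a 0 i)) !intrM.
  by rewrite mulrC mulrA divfK // intr_eq0 denq_neq0.
by case: (z i) => m; rewrite ?subr0 // NegzE sub0r mulrNz.
Qed.

Theorem theorem3 (R : realType) (k : nat) (hk : (3 <= k.+1)%N)
    (a : 'rV[R]_k) (b : R) (ha : a != 0) :
  (exists (n : nat) (phi : counts k.+1 n -> R), ntub (loglinear_null a b) phi)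
  <->
  (exists (a' : 'rV[rat]_k) (b' : R),
     loglinear_null a b = loglinear_null (map_mx (@ratr R) a') b').
Proof.
split=> [[n [phi /ntub_rational]]|[a' [b' E]]]; first exact.
have [c c0 [f [g cE]]] := rat_row_scale R a'.
(* Non-emptiness comes from [a != 0] and is then transported along [E] and the rescaling to the
   integer coefficients. *)
have := loglinear_null_nonempty b ha; have := alternative_nonempty b ha.
rewrite E -(loglinear_nullZ _ _ c0) cE => alt null.
exact: natural_ntub.
Qed.
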